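(* Let $2\leqslant n\in\mathbb{N}^+$, $2\leqslant b\in\mathbb{N}^+$ and $\tau\geqslant n-1$ (real), and let $\varphi(x)\geqslant 0$ be a non-decreasing function on $[0,+\infty)$. Assume that $$\sum_{\nu=0}^\infty \frac{1}{\varphi(b^{\nu-1})}<+\infty .$$ Then $$\mathcal{H}^{\tau+1}_\varphi(\mathbb{T}^n)\subset \widetilde{\mathcal{L}^2_{\tau+1,b}}(\mathbb{T}^n).$$
   Context: $\mathbb{T}^n:=\mathbb{R}^n/2\pi\mathbb{Z}^n$. Functions are real mappings $f:\mathbb{T}^n\to\mathbb{R}^n$ with Fourier expansion $f(x)=\sum_{k\in\mathbb{Z}^n} f_k e^{\mathrm{i}\langle k,x\rangle}$, where $\langle k,x\rangle=\sum_{j=1}^n k_jx_j$ and $f_k=\int_{\mathbb{T}^n} f(x)e^{-\mathrm{i}\langle k,x\rangle}\,dx$ (the measure being normalized so that the expansion holds). For $k\in\mathbb{Z}^n$, $|k|:=\sum_{j=1}^n|k_j|$. Define $$\widetilde{\mathcal{L}^2_{\tau+1,b}}(\mathbb{T}^n):=\Big\{f:\ \sum_{\nu=0}^\infty\Big(\sum_{b^{\nu-1}<|k|\leqslant b^\nu}|f_k|^2|k|^{2\tau+2}\Big)^{1/2}<+\infty\Big\},$$ $$\mathcal{H}^{\tau+1}_\varphi(\mathbb{T}^n):=\Big\{f:\ \Big(\sum_{k\in\mathbb{Z}^n}|f_k|^2|k|^{2\tau+2}\varphi(|k|)\Big)^{1/2}<+\infty\Big\}.$$ Convention: $1/0=+\infty$.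 *)

(* Defs.v *)
From HB Require Import structures.
From mathcomp Require Import all_boot all_order all_algebra.
From mathcomp Require Import all_classical all_reals all_analysis.
From mathcomp Require Import complex.

Set Implicit Arguments.
Unset Strict Implicit.
Unset Printing Implicit Defensive.

Import Order.TTheory GRing.Theory Num.Theory.
Import numFieldNormedType.Exports.

Local Open Scope classical_set_scope.
Local Open Scope ring_scope.
Local Open Scope complex_scope.

Section torus_measure.
Variable R : realType.

Local Notation point n := (n.-tuple (measurableTypeR R)).

Definition tcons n (x : measurableTypeR R * point n) : point n.+1 :=
  [tuple of x.1 :: x.2].

Lemma measurable_tcons n : measurable_fun [set: _] (@tcons n).
Proof. exact: measurable_cons. Qed.

HB.instance Definition _ n :=
  isMeasurableFun.Build _ _ _ _ (@tcons n) (@measurable_tcons n).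

Lemma pi2_gt0 : (0 : R) < pi *+ 2.
Proof. by rewrite pmulrn_lgt0// pi_gt0. Qed.

(* The normalized Lebesgue (Haar) measure of R^n / 2 pi Z^n, seen as a
   probability on R^n carried by the fundamental domain [0, 2 pi]^n: the n-fold
   product of the uniform probability on [0, 2 pi]. *)
Fixpoint torus_measure n : probability (point n) R :=
  match n with
  | 0 => \d_ [tuple]
  | m.+1 => distribution (uniform_prob pi2_gt0 \x torus_measure m)%E
              (@tcons m : {mfun _ >-> _})
  end.

Lemma torus_measure_box n (A : 'I_n -> set (measurableTypeR R)) :
  (forall i, measurable (A i)) ->
  torus_measure n [set x | forall i, A i (tnth x i)] =
  (\prod_(i < n) uniform_prob pi2_gt0 (A i))%E.
Proof.
elim: n A => [|n IH] A mA.
  by rewrite /= big_ord0 diracE mem_set// => -[].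
rewrite big_ord_recl /= /distribution /pushforward.
rewrite [X in product_measure1 _ _ X](_ : _ = A ord0 `*`
    [set x | forall i, A (lift ord0 i) (tnth x i)]); last first.
  apply/seteqP; split => [[x y] /= Axy|[x y] /= [Ax Ay] i].
    split; first by have := Axy ord0.
    by move=> i; have := Axy (lift ord0 i); rewrite tnthS.
  by case: (unliftP ord0 i) => [j ->|->]; rewrite ?tnthS//; exact: Ay.
suff mB : measurable [set x | forall i, A (lift ord0 i) (tnth x i)].
  by rewrite product_measure1E//; congr (_ * _)%E; exact: IH.
rewrite (_ : [set x | _] = \bigcap_(i in [set: 'I_n])
    ((fun x : point n => tnth x i) @^-1` A (lift ord0 i))); last first.
  by apply/seteqP; split => [x Ax i _|x Ax i]; [exact: Ax|exact: Ax].
apply: fin_bigcap_measurable => // i _.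
by rewrite -[X in measurable X]setTI; exact: measurable_tnth.
Qed.

End torus_measure.

Section fourier.
Variables (R : realType) (n : nat).

Local Notation point := (n.-tuple (measurableTypeR R)).

Implicit Types (k : 'rV[int]_n) (x : point) (f : point -> point).

Definition l1norm k : nat := (\sum_(j < n) `|k 0%R j|)%N.

Definition pairing k x : R := \sum_(j < n) (k 0 j)%:~R * tnth x j.

Definition cis (t : R) : R[i] := cos t +i* sin t.

(* The Hermitian norm of C^n; any other norm yields the same spaces. *)
Definition vnorm (v : 'rV[R[i]]_n) : R :=
  Num.sqrt (\sum_(j < n) ComplexField.Normc.normc (v 0 j) ^+ 2).

Definition torus_Cintegral (g : point -> R[i]) : R[i] :=
  (\int[torus_measure R n]_x complex.Re (g x)) +i*
  (\int[torus_measure R n]_x complex.Im (g x)).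

Definition fourier_coef f k : 'rV[R[i]]_n :=
  \row_j torus_Cintegral (fun x => (tnth (f x) j)%:C * cis (- pairing k x)).

Definition fourier_sum f (N : nat) x : 'rV[R[i]]_n :=
  \sum_(k \in [set k | (l1norm k <= N)%N]) cis (pairing k x) *: fourier_coef f k.

Definition torus_periodic f :=
  forall (m : 'rV[int]_n) x,
    f [tuple tnth x j + (pi *+ 2) * (m 0 j)%:~R | j < n] = f x.

(* Maps T^n -> R^n are 2 pi Z^n-periodic maps R^n -> R^n; integrability makes
   the Fourier coefficients meaningful.  The expansion is required for almost
   every x, with partial sums over |k| <= N.  It is automatic for integrable
   maps with absolutely summable coefficients, in particular as soon as
   sum_k |f_k|^2 |k|^(2 tau + 2) is finite with tau >= n - 1 and n >= 2. *)
Definition torus_function f :=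
  [/\ torus_periodic f,
      forall j, (torus_measure R n).-integrable setT (fun x => (tnth (f x) j)%:E)
    & {ae torus_measure R n, forall x,
        vnorm (fourier_sum f N x - \row_j (tnth (f x) j)%:C) @[N --> \oo] --> 0}].

Definition annulus (b nu : nat) : set 'rV[int]_n :=
  [set k | (b%:R : R) ^ (nu%:Z - 1) < (l1norm k)%:R <= (b%:R : R) ^ nu].

(* Powers of |k| are powR, so the k = 0 term vanishes once 2 tau + 2 > 0. *)
Definition sob_term (tau : R) f k : R :=
  vnorm (fourier_coef f k) ^+ 2 * (l1norm k)%:R `^ (2 * tau + 2).

Definition Ltilde (tau : R) (b : nat) : set (point -> point) :=
  [set f | torus_function f /\
    (\sum_(0 <= nu <oo)
       (\esum_(k in annulus b nu) (sob_term tau f k)%:E) `^ 2^-1 < +oo)%E].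

Definition Hphi (tau : R) (phi : R -> R) : set (point -> point) :=
  [set f | torus_function f /\
    ((\esum_(k in [set: 'rV[int]_n]) (sob_term tau f k * phi (l1norm k)%:R)%:E)
       `^ 2^-1 < +oo)%E].

End fourier.

(* Main.v *)
Require Import Defs.
From mathcomp Require Import all_boot all_order all_algebra.
From mathcomp Require Import all_classical all_reals all_analysis.
From mathcomp Require Import lra.

Import Order.TTheory GRing.Theory Num.Theory.
Import numFieldNormedType.Exports.

Local Open Scope classical_set_scope.
Local Open Scope ring_scope.

(** Write p_nu for phi (b ^ (nu - 1)) and S_nu for the sum of
    |f_k|^2 |k|^(2 tau + 2) over the annulus b ^ (nu - 1) < |k| <= b ^ nu.
    Convergence of sum_nu 1 / p_nu forces every p_nu to be positive, so that
    the elementary inequality sqrt S <= 1 / p + p S, which is all that remains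
    of Cauchy-Schwarz when only finiteness matters, applies to each annulus
    ([sqrte_le_inveD]).  The terms 1 / p_nu sum to a finite value by
    hypothesis.  For the terms p_nu S_nu, monotonicity of phi gives
    p_nu <= phi |k| on the annulus, and the annuli are pairwise disjoint
    ([trivIset_annulus]), so sum_nu p_nu S_nu is at most the squared
    H_phi-norm of f.  The argument concerns only nonnegative families, and is
    carried out for those in [nneseries_sqrt_esum_lty]. *)

(** The weight p is free: AM-GM would give the bound with a factor 1/2, the
    constant being irrelevant here.  The value x = +oo is allowed. *)
Lemma sqrte_le_inveD (R : realType) (p : R) (x : \bar R) :
  0 < p -> (0 <= x)%E -> (x `^ 2^-1 <= (p%:E)^-1 + p%:E * x)%E.
Proof.
move=> p0; rewrite inver gt_eqF//; case: x => [x| |]//; last first.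
  by move=> _; rewrite gt0_muley ?lte_fin// addey// leey.
rewrite lee_fin => x0; rewrite poweR_EFin -EFinM -EFinD lee_fin powR12_sqrt//.
have {2}-> : x = Num.sqrt x ^+ 2 by rewrite sqr_sqrtr.
set s := Num.sqrt x.
have -> : p^-1 + p * s ^+ 2 = p^-1 * (1 + (p * s) ^+ 2).
  by rewrite mulrDr mulr1 exprMn expr2 -!mulrA mulKf// gt_eqF.
rewrite mulrC ler_pdivlMr//; have : 0 <= (p * s - 2^-1) ^+ 2 by exact: sqr_ge0.
nra.
Qed.

Lemma mule_esum_le (R : realType) (T : choiceType) (A : set T) (p : R)
    (a w : T -> \bar R) : 0 < p -> (forall x, 0 <= a x)%E ->
  (forall x, A x -> p%:E * a x <= w x)%E ->
  (p%:E * (\esum_(x in A) a x) <= \esum_(x in A) w x)%E.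
Proof.
move=> p0 a0 aw; rewrite -lee_pdivlMl// ge_ereal_sup// => _ [X [finX XA] <-].
rewrite lee_pdivlMl// ge0_mule_fsumr//; apply: esum_ge; exists X => //.
by apply: lee_fsum => // x /XA; exact: aw.
Qed.

(** The inclusion, stripped of its Fourier-analytic content: a is the family
    of squared coefficients, w its weighted version, and p nu a lower bound of
    the weight on the block A nu. *)
Lemma nneseries_sqrt_esum_lty (R : realType) (T : choiceType)
    (A : (set T)^nat) (p : nat -> R) (a w : T -> \bar R) :
  trivIset setT A -> (forall x, 0 <= a x)%E -> (forall x, 0 <= w x)%E ->
  (forall nu, 0 <= p nu) ->
  (forall nu x, A nu x -> (p nu)%:E * a x <= w x)%E ->
  (\sum_(0 <= nu <oo) ((p nu)%:E)^-1 < +oo)%E ->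
  (\esum_(x in [set: T]) w x < +oo)%E ->
  (\sum_(0 <= nu <oo) (\esum_(x in A nu) a x) `^ 2^-1 < +oo)%E.
Proof.
move=> tA a0 w0 p0 aw sump sumw.
have pV0 nu : (0 <= ((p nu)%:E)^-1)%E by rewrite inve_ge0 lee_fin.
(* a vanishing p nu would contribute 1/0 = +oo to the series of inverses *)
have {}p0 nu : 0 < p nu.
  rewrite lt_neqAle p0 andbT eq_sym; apply/eqP => pnu0.
  move: sump; apply/negP; rewrite -leNgt.
  rewrite (le_trans _ (@nneseries_lim_ge _ _ xpredT 0 nu.+1 _))//.
  rewrite big_nat_recr//= pnu0 inve0 addey ?leey//.
  by rewrite -ltNye (lt_le_trans (ltNyr 0))// sume_ge0.
apply: (@le_lt_trans _ _ (\sum_(0 <= nu <oo)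
    (((p nu)%:E)^-1 + \esum_(x in A nu) w x))%E).
  apply: lee_nneseries => [nu _ _|nu _]; first exact: poweR_ge0.
  apply: (le_trans (sqrte_le_inveD _ _ _ (p0 nu) _)); first exact: esum_ge0.
  by rewrite leeD2l// mule_esum_le// => x; exact: aw.
have sumA : (\sum_(0 <= nu <oo) \esum_(x in A nu) w x < +oo)%E.
  apply: le_lt_trans sumw; rewrite -nneseries_sum_bigcup//.
  by apply: le_ereal_sup => _ [X [finX _] <-]; exists X.
by rewrite nneseriesD ?lte_add_pinfty// => nu _ _; exact: esum_ge0.
Qed.

(** For nu < nu', the outer radius b ^ nu of one annulus is at most the
    (excluded) inner radius b ^ (nu' - 1) of the other. *)
Lemma trivIset_annulus (R : realType) (n b : nat) :
  (0 < b)%N -> trivIset setT (@annulus R n b).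
Proof.
move=> b0; apply: ltn_trivIset => nu' nu ltnu; apply/seteqP; split=> // k [].
move=> /andP[_ hik] /andP[lok _].
have := lt_le_trans lok hik; rewrite ltNge => /negP; apply.
rewrite ler_weXz2l ?ler1n//; case: nu' ltnu {lok hik} => // m.
by rewrite intS addrAC subrr add0r.
Qed.

(* The convention 1/0 = +oo is the library's inve0. *)
Theorem theorem1p1 (R : realType) (n b : nat) (tau : R) (phi : R -> R)
  (hn : (2 <= n)%N) (hb : (2 <= b)%N) (htau : n%:R - 1 <= tau)
  (phi_ge0 : forall x, 0 <= x -> 0 <= phi x)
  (phi_nd : forall x y, 0 <= x -> x <= y -> phi x <= phi y)
  (hsum : (\sum_(0 <= nu <oo)
            ((phi ((b%:R : R) ^ (nu%:Z - 1)))%:E)^-1 < +oo)%E) :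
  @Hphi R n tau phi `<=` @Ltilde R n tau b.
Proof.
move=> f [torf Hf]; split => //.
have a0 k : 0 <= sob_term tau f k by rewrite mulr_ge0 ?powR_ge0 ?sqr_ge0.
have r0 nu : 0 <= (b%:R : R) ^ (nu%:Z - 1) by rewrite exprz_ge0.
apply: (@nneseries_sqrt_esum_lty _ _ (@annulus R n b) (fun nu => phi (b%:R ^ (nu%:Z - 1))) _
  (fun k => (sob_term tau f k * phi (l1norm k)%:R)%:E)) hsum _.
- exact/trivIset_annulus/(leq_trans _ hb).
- by move=> k; rewrite lee_fin.
- by move=> k; rewrite lee_fin mulr_ge0 ?phi_ge0.
- by move=> nu; exact/phi_ge0/r0.
- move=> nu k /andP[/ltW lok _].
  by rewrite -EFinM lee_fin mulrC ler_wpM2l// phi_nd.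
- (* taking the square root does not change finiteness *)
  by rewrite ltNge leye_eq; apply: contraTN Hf => /eqP ->; rewrite poweRyr.
Qed.
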